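(* Let $(X,\|\cdot\|_X)$ and $(U,\|\cdot\|_U)$ be Banach spaces, let $\mathcal U:=PC(\mathbb R_{\ge 0};U)$, and let $\Sigma=(X,\mathcal U,\phi)$ be a forward complete control system with $x\equiv 0$ being its equilibrium point. Suppose that there exist a continuous functional $V:X\to\mathbb R_{\ge 0}$, functions $\psi_1,\psi_2\in\mathcal K_\infty$ and $\mu,\rho\in\mathcal K$, and a constant $\lambda_0>0$ such that: (i) for every $x\in X$, $0\le V(x)\le\psi_1(\|x\|_X)$; (ii) for all $x,z\in X$, $\psi_2(\|x\|_X)\le V(x-z)+V(-x-z)+\mu(\|z\|_X)$; (iii') for every $T>0$ and every $u\in\mathcal U$ there is $z_{u,T}\in X$ with $\|z_{u,T}\|_X\le\rho\big(\sup_{t\in(0,T)}\|u(t)\|_U\big)$ such that the derivative of $V(x-z_{u,T})+V(-x-z_{u,T})$ along the trajectory satisfies, for all $t\in(0,T)$, $$\dot V(x-z_{u,T})+\dot V(-x-z_{u,T})\le-\lambda_0\big(V(x-z_{u,T})+V(-x-z_{u,T})\big).$$ Then $\Sigma$ is input-to-state stable (ISS), having the following estimate for all $t>0$ (and all $x\in X$, $u\in\mathcal U$): $$\psi_2\big(\|\phi(t,x,u)\|_X\big)\le 2e^{-\lambda_0 t}\psi_1(2\|x\|_X)+\gamma\Big(\sup_{s\in(0,t)}\|u(s)\|_U\Big),$$ with $\gamma(\cdot):=2\psi_1(2\rho(\cdot))+\mu(\rho(\cdot))\in\mathcal K_\infty$.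
   Context: Notation. $\mathcal K$: continuous strictly increasing $\gamma:\mathbb R_{\ge0}\to\mathbb R_{\ge0}$ with $\gamma(0)=0$. $\mathcal K_\infty$: those $\gamma\in\mathcal K$ with $\gamma(s)\to+\infty$ as $s\to+\infty$. $\mathcal L$: continuous strictly decreasing functions $\mathbb R_{\ge0}\to\mathbb R_{\ge0}$ tending to $0$ at $+\infty$. $\mathcal{KL}$: continuous $\beta:\mathbb R_{\ge0}\times\mathbb R_{\ge0}\to\mathbb R_{\ge0}$ with $\beta(\cdot,t)\in\mathcal K$ for all $t\ge0$ and $\beta(s,\cdot)\in\mathcal L$ for all $s>0$. $PC(\mathbb R_{\ge0};U)$: the set of piecewise right-continuous functions $f:\mathbb R_{\ge0}\to U$ with $\|f\|_{PC}:=\sup_{t\ge0}\|f(t)\|_U<\infty$; this is the norm $\|\cdot\|_{\mathcal U}$. Derivative along the trajectory: the right-hand upper Dini derivative in time, $D^+v(t):=\limsup_{\tau\to0^+}\frac{v(t+\tau)-v(t)}{\tau}$, of the functional evaluated along $t\mapsto\phi(t,x,u)$; in (iii') this means that $v(t):=V(\phi(t,x,u)-z_{u,T})+V(-\phi(t,x,u)-z_{u,T})$ satisfies $D^+v(t)\le-\lambda_0v(t)$ for $t\in(0,T)$. Control system. The input space $\mathcal U$ is a normed vector space of functions $\mathbb R_{\ge0}\to U$ that is shift invariant ($u(\cdot+\tau)\in\mathcal U$ and $\|u(\cdot+\tau)\|_{\mathcal U}\le\|u\|_{\mathcal U}$ for all $u\in\mathcal U$, $\tau\ge0$) and closed under concatenation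 (for $u_1,u_2\in\mathcal U$ and $t>0$, the function equal to $u_1(\tau)$ for $\tau\in[0,t]$ and to $u_2(\tau-t)$ otherwise is in $\mathcal U$). A triple $\Sigma=(X,\mathcal U,\phi)$ with $\phi:D_\phi\to X$, $D_\phi\subseteq\mathbb R_{\ge0}\times X\times\mathcal U$, is a control system if: (identity) $\phi(0,x,u)=x$; (causality) $\phi(t,x,u)=\phi(t,x,\tilde u)$ whenever $u=\tilde u$ on $[0,t]$; (continuity) $t\mapsto\phi(t,x,u)$ is continuous for all $(x,u)$; (cocycle) $\phi(h,\phi(t,x,u),u(t+\cdot))=\phi(t+h,x,u)$ for all $t,h\ge0$. It is forward complete if $D_\phi=\mathbb R_{\ge0}\times X\times\mathcal U$. The point $0\in X$ is an equilibrium if $\phi(t,0,0)=0$ for all $t\ge0$. ISS. $\Sigma$ is ISS if there are $\beta\in\mathcal{KL}$ and $\tilde\gamma\in\mathcal K$ with $\|\phi(t,x,u)\|_X\le\beta(\|x\|_X,t)+\tilde\gamma(\|u\|_{\mathcal U})$ for all $(t,x,u)\in\mathbb R_{\ge0}\times X\times\mathcal U$.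
   Formalization: The claim that γ is in K∞ is false for ρ merely in K (a bounded ρ gives a bounded γ); it is replaced by: γ is in K always, and γ is in K∞ whenever ρ is in K∞. ISS and the estimate are unchanged. *)

(* Defs.v *)
From HB Require Import structures.
From mathcomp Require Import all_boot all_order all_algebra.
From mathcomp Require Import all_classical all_reals all_analysis.

Set Implicit Arguments.
Unset Strict Implicit.
Unset Printing Implicit Defensive.

Import Order.TTheory GRing.Theory Num.Theory.
Import numFieldNormedType.Exports.

Local Open Scope classical_set_scope.
Local Open Scope ring_scope.

(* Functions on the half-line are represented by total functions on R; every
   predicate below constrains their values at nonnegative arguments only. *)

Section comparison_functions.
Context {R : realType}.

Definition Rge0 : set R := [set t | 0 <= t].

Definition classK (g : R -> R) : Prop :=
  [/\ {within Rge0, continuous g},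
      (forall s, 0 <= s -> 0 <= g s),
      (forall r s, 0 <= r -> r < s -> g r < g s) &
      g 0 = 0].

Definition classKinfty (g : R -> R) : Prop :=
  classK g /\ g s @[s --> +oo] --> +oo.

Definition classL (g : R -> R) : Prop :=
  [/\ {within Rge0, continuous g},
      (forall s, 0 <= s -> 0 <= g s),
      (forall r s, 0 <= r -> r < s -> g s < g r) &
      g s @[s --> +oo] --> (0 : R)].

Definition classKL (b : R -> R -> R) : Prop :=
  [/\ {within Rge0 `*` Rge0, continuous (fun p : R * R => b p.1 p.2)},
      (forall t, 0 <= t -> classK (fun s => b s t)) &
      (forall s, 0 < s -> classL (b s))].

(* The Dini derivative may be infinite, hence the codomain \bar R. *)
Definition upper_right_dini (v : R -> R) (t : R) : \bar R :=
  limf_esup (fun tau => ((v (t + tau) - v t) / tau)%:E) (0 : R)^'+.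

End comparison_functions.

Section inputs.
Context {R : realType} {U : normedModType R}.
Implicit Types (u : R -> U) (A : set (R -> U)) (N : (R -> U) -> R).

Definition eq_on_Rge0 u1 u2 : Prop := forall t, 0 <= t -> u1 t = u2 t.

Definition input_shift (tau : R) u : R -> U := fun t => u (t + tau).

Definition input_concat (t : R) u1 u2 : R -> U :=
  fun s => if s <= t then u1 s else u2 (s - t).

(* Elements of A that agree on the half-line are the same input, so the
   separation axiom of the norm N is stated up to eq_on_Rge0. *)
Record is_input_space A N : Prop := IsInputSpace {
  input_zero : A (fun=> 0) ;
  input_add : forall u1 u2, A u1 -> A u2 -> A (fun t => u1 t + u2 t) ;
  input_scale : forall (a : R) u, A u -> A (fun t => a *: u t) ;
  input_norm_ge0 : forall u, A u -> 0 <= N u ;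
  input_norm_eq0 : forall u, A u -> N u = 0 -> eq_on_Rge0 u (fun=> 0) ;
  input_norm_scale : forall (a : R) u, A u ->
    N (fun t => a *: u t) = `|a| * N u ;
  input_norm_triangle : forall u1 u2, A u1 -> A u2 ->
    N (fun t => u1 t + u2 t) <= N u1 + N u2 ;
  input_shift_closed : forall u tau, A u -> 0 <= tau ->
    A (input_shift tau u) /\ N (input_shift tau u) <= N u ;
  input_concat_closed : forall u1 u2 t, A u1 -> A u2 -> 0 < t ->
    A (input_concat t u1 u2) }.

(* The half-line is cut into intervals by a locally finite set D of
   breakpoints, and u is right-continuous on each of them.  A breakpoint may
   close the interval on its left as well as open the one on its right:
   concatenation of inputs keeps the value of the first one at the
   switching time. *)
Definition piecewise_right_continuous u : Prop :=
  exists D : set R,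
    (forall T, finite_set (D `&` `[0, T])) /\
    (forall t, 0 <= t -> ~ D t -> u s @[s --> t^'+] --> u t).

Definition PC : set (R -> U) :=
  [set u | piecewise_right_continuous u /\
           exists M, forall t, 0 <= t -> `|u t| <= M].

Definition sup_norm_on (I : set R) u : R := sup [set `|u t| | t in I].

Definition PC_norm u : R := sup_norm_on Rge0 u.

End inputs.
Arguments PC {R} U.

Section PC_is_input_space.
Context {R : realType} {U : normedModType R}.
Implicit Types (u : R -> U).

Let at_right_shift (a t : R) : (fun s => s + a) @ t^'+ `=>` (t + a)^'+.
Proof.
move=> P [e /= e0 He]; exists e => //= y ty ty'.
apply: He => /=; last by rewrite ltrD2r.
by rewrite opprD addrACA subrr addr0.
Qed.

Let cvg_right_shift u (a t : R) (l : U) :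
  u s @[s --> (t + a)^'+] --> l -> u (s + a) @[s --> t^'+] --> l.
Proof. by move=> h P /h; exact: (@at_right_shift a t). Qed.

Let has_sup_PC u : PC U u -> has_sup [set `|u t| | t in Rge0].
Proof.
move=> [_ [M uM]]; split; first by exists `|u 0|, 0 => //; exact: lexx.
by exists M => _ [t t0 <-]; exact: uM.
Qed.

Let PC_norm_ub u t : PC U u -> 0 <= t -> `|u t| <= PC_norm u.
Proof.
by move=> uPC t0; apply: (sup_upper_bound (has_sup_PC uPC)); exists t.
Qed.

Let PC_norm_le u (M : R) :
  (forall t, 0 <= t -> `|u t| <= M) -> PC_norm u <= M.
Proof.
move=> uM; apply: ge_sup; first by exists `|u 0|, 0 => //; exact: lexx.
by move=> _ [t t0 <-]; exact: uM.
Qed.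

Let PC_norm_ge0 u : PC U u -> 0 <= PC_norm u.
Proof. by move=> uPC; rewrite (le_trans _ (PC_norm_ub uPC (lexx 0))). Qed.

Let PC_zero : PC U (fun=> 0).
Proof.
split; last by exists 0 => t _; rewrite normr0.
exists set0; split => [T|t _ _]; last exact: cvg_cst.
by rewrite set0I; exact: finite_set0.
Qed.

Let PC_add u1 u2 : PC U u1 -> PC U u2 -> PC U (fun t => u1 t + u2 t).
Proof.
move=> [[D1 [fin1 cvg1]] [M1 le1]] [[D2 [fin2 cvg2]] [M2 le2]]; split.
  exists (D1 `|` D2); split => [T|t t0 /not_orP[t1 t2]].
    by rewrite setIUl finite_setU; split.
  by apply: cvgD; [exact: cvg1|exact: cvg2].
exists (M1 + M2) => t t0.
by rewrite (le_trans (ler_normD _ _))// lerD ?le1 ?le2.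
Qed.

Let PC_scale (a : R) u : PC U u -> PC U (fun t => a *: u t).
Proof.
move=> [[D [finD cvgD]] [M leM]]; split.
  by exists D; split => // t t0 Dt; apply: cvgZl_tmp; exact: cvgD.
by exists (`|a| * M) => t t0; rewrite normrZ ler_wpM2l ?leM.
Qed.

Let PC_scale_norm (a : R) u : PC U u ->
  PC_norm (fun t => a *: u t) = `|a| * PC_norm u.
Proof.
move=> uPC; apply/eqP; rewrite eq_le; apply/andP; split.
  by apply: PC_norm_le => t t0; rewrite normrZ ler_wpM2l ?PC_norm_ub.
have [->|a0] := eqVneq a 0.
  by rewrite normr0 mul0r PC_norm_ge0//; exact: PC_scale.
rewrite mulrC -ler_pdivlMr ?normr_gt0//; apply: PC_norm_le => t t0.
rewrite ler_pdivlMr ?normr_gt0// mulrC -normrZ.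
exact: (PC_norm_ub (PC_scale a uPC)).
Qed.

Let PC_shift u (tau : R) : PC U u -> 0 <= tau -> PC U (input_shift tau u).
Proof.
move=> [[D [finD cvgD]] [M leM]] tau0; split; last first.
  by exists M => t t0; apply: leM; exact: addr_ge0.
exists [set t | D (t + tau)]; split => [T|t t0 Dt].
  apply: (@sub_finite_set _ _ ((fun s => s - tau) @` (D `&` `[0, T + tau]))).
    move=> t [/= Dt]; rewrite in_itv/= => /andP[t0 tT].
    exists (t + tau); last by rewrite addrK.
    by split => //=; rewrite in_itv/= addr_ge0//= lerD2r.
  exact/finite_image/finD.
by apply: cvg_right_shift; apply: cvgD => //; exact: addr_ge0.
Qed.

Let PC_concat u1 u2 (t : R) : PC U u1 -> PC U u2 -> 0 < t ->
  PC U (input_concat t u1 u2).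
Proof.
move=> [[D1 [fin1 cvg1]] [M1 le1]] [[D2 [fin2 cvg2]] [M2 le2]] t0; split.
  exists ([set t] `|` (D1 `|` [set s | t < s /\ D2 (s - t)])); split.
    move=> T; rewrite 2!setIUl 2!finite_setU; split.
      by apply: (@sub_finite_set _ _ [set t]) => [s []//|]; exact: finite_set1.
    split => //.
    apply: (@sub_finite_set _ _ ((fun s => s + t) @` (D2 `&` `[0, T]))).
      move=> s [/= [ts Ds]]; rewrite in_itv/= => /andP[_ sT].
      exists (s - t); last by rewrite subrK.
      split => //=; rewrite in_itv/= subr_ge0 (ltW ts)/=.
      by rewrite lerBlDr (le_trans sT)// lerDl ltW.
    exact/finite_image/fin2.
  move=> s s0 /not_orP[/eqP st /not_orP[Ds1 Ds2]].
  have [ts|ts|ts] := ltgtP s t; last by rewrite ts eqxx in st.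
    rewrite /input_concat (ltW ts).
    apply: cvg_trans (cvg1 s s0 Ds1); apply: near_eq_cvg.
    near=> r; have rt : r < t by near: r; exact: nbhs_right_lt.
    by rewrite (ltW rt).
  rewrite {2}/input_concat leNgt ts/=.
  have Hs : u2 (r - t) @[r --> s^'+] --> u2 (s - t).
    apply: cvg_right_shift; apply: cvg2; first by rewrite subr_ge0 ltW.
    by move=> D2s; apply: Ds2.
  apply: cvg_trans Hs; apply: near_eq_cvg.
  near=> r; have sr : s < r by near: r; exact: nbhs_right_gt.
  by rewrite /input_concat leNgt (lt_trans ts sr).
exists (Num.max M1 M2) => s s0; rewrite /input_concat le_max.
have [st|st] := leP s t; first by rewrite le1.
by rewrite le2 ?orbT// subr_ge0 ltW.
Unshelve. all: by end_near. Qed.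

Lemma PC_input_space : is_input_space (PC U) PC_norm.
Proof.
split => //.
- move=> u uPC u0 t t0; apply/eqP; rewrite -normr_le0 -u0.
  exact: PC_norm_ub.
- move=> u1 u2 h1 h2; apply: PC_norm_le => t t0.
  by rewrite (le_trans (ler_normD _ _))// lerD ?PC_norm_ub.
- move=> u tau uPC tau0; split; first exact: PC_shift.
  apply: PC_norm_le => t t0; rewrite /input_shift.
  by apply: (PC_norm_ub (t := t + tau)) => //; exact: addr_ge0.
Qed.

End PC_is_input_space.

Section control_systems.
Context {R : realType} {X U : normedModType R}.
Implicit Types (A : set (R -> U)) (N : (R -> U) -> R) (x : X) (u : R -> U).
Implicit Types (phi : R -> X -> (R -> U) -> X).

(* The domain of phi is the set of (t, x, u) with 0 <= t and A u; causality
   makes phi t x u independent of the values of u at negative times. *)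
Record forward_complete_control_system A N phi : Prop :=
  ForwardCompleteControlSystem {
  inputs_space : is_input_space A N ;
  flow_identity : forall x u, A u -> phi 0 x u = x ;
  flow_causality : forall t x u1 u2, 0 <= t -> A u1 -> A u2 ->
    (forall s, 0 <= s <= t -> u1 s = u2 s) -> phi t x u1 = phi t x u2 ;
  flow_continuity : forall x u, A u ->
    {within Rge0, continuous (fun t => phi t x u)} ;
  flow_cocycle : forall t h x u, 0 <= t -> 0 <= h -> A u ->
    phi h (phi t x u) (input_shift t u) = phi (t + h) x u }.

Definition zero_equilibrium phi : Prop :=
  forall t, 0 <= t -> phi t 0 (fun=> 0) = 0.

Definition ISS A N phi : Prop :=
  exists (beta : R -> R -> R) (gamma : R -> R),
    [/\ classKL beta, classK gamma &
        forall t x u, 0 <= t -> A u ->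
          `|phi t x u| <= beta `|x| t + gamma (N u)].

End control_systems.

(* Main.v *)
(* Along a trajectory, v(t) = V(phi(t) - z) + V(- phi(t) - z) satisfies
   D^+ v <= - lambda0 v on (0, T), hence v(T) <= exp(- lambda0 T) v(0) by a
   comparison argument.  Since |x -+ z| <= 2 max(|x|, |z|), (i) bounds v(0) by
   2 psi1(2|x|) + 2 psi1(2|z|), and (ii) turns the bound on v(T) into the
   claimed estimate.  ISS follows by applying psi2^-1, which satisfies
   psi2^-1(a + b) <= psi2^-1(2a) + psi2^-1(2b). *)
Require Import Defs.
From mathcomp Require Import all_boot all_order all_algebra.
From mathcomp Require Import all_classical all_reals all_analysis.
From mathcomp Require Import ring lra.
Import Order.TTheory GRing.Theory Num.Theory.
Import numFieldNormedType.Exports.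
Local Open Scope classical_set_scope.
Local Open Scope ring_scope.

Set Implicit Arguments.
Unset Strict Implicit.
Unset Printing Implicit Defensive.

(** * Upper Dini derivatives and comparison with differentiable functions *)

Section dini.
Context {R : realType}.
Implicit Types v y : R -> R.

(** The limsup is an infimum of suprema over neighbourhoods, so one neighbourhood already keeps all
    its quotients below [m]. *)
Lemma upper_right_dini_lt v (t m : R) :
  (upper_right_dini v t < m%:E)%E ->
  \forall tau \near 0^'+, v (t + tau) - v t < m * tau.
Proof.
move=> /ereal_inf_lt[_ [A A0 <-] Am].
near=> tau.
have tau0 : 0 < tau by near: tau; exact: nbhs_right_gt.
rewrite -ltr_pdivrMr// -lte_fin; apply: le_lt_trans Am.
by apply: ereal_sup_ubound; exists tau => //; near: tau; exact: A0.
Unshelve. all: by end_near. Qed.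

Lemma is_derive_right_gt y (t m d : R) : is_derive t 1 y d -> m < d ->
  \forall tau \near 0^'+, m * tau < y (t + tau) - y t.
Proof.
move=> [yt yd] md.
have := cvg_dnbhs_at_right yt; rewrite -/('D_1 y t) yd.
move=> /(cvgr_gt d) /(_ m md) H.
near=> tau.
have tau0 : 0 < tau by near: tau; exact: nbhs_right_gt.
rewrite -ltr_pdivlMr// mulrC.
have : m < tau^-1 *: ((y \o shift t) (tau *: 1) - y t) by near: tau; exact: H.
by rewrite /= [_ *: 1]mulr1 [t + _]addrC.
Unshelve. all: by end_near. Qed.

(* At the last time where [v <= y] the two functions agree, so the Dini
   derivative of [v] there must be at least the derivative of [y]. *)
Lemma dini_comparison v y (dy : R -> R) (a b : R) : a <= b ->
  continuous v -> (forall t : R, is_derive t 1 y (dy t)) -> v a < y a ->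
  (forall t, a < t < b -> v t = y t -> (upper_right_dini v t < (dy t)%:E)%E) ->
  v b <= y b.
Proof.
move=> ab cv dery vya dini; rewrite leNgt; apply/negP => yvb.
have cy : continuous y.
  move=> t; apply: differentiable_continuous; apply/derivable1_diffP.
  by case: (dery t).
pose f t := v t - y t.
have cf : continuous f by move=> t; apply: cvgB; [exact: cv|exact: cy].
pose S := [set t | a <= t <= b] `&` [set t | f t <= 0].
have Sa : S a by split; rewrite /= ?lexx ?ab// subr_le0 ltW.
have ubS : has_ubound S by exists b => t [/andP[]].
have cS : closed S.
  apply: closedI.
    rewrite (_ : [set t | _] = [set t | a <= t] `&` [set t | t <= b]).
      by apply: closedI; [exact: closed_ge|exact: closed_le].
    by apply/seteqP; split => t /=; [move=> /andP|move=> [-> ->]].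
  by apply: (@closed_comp _ _ f [set t | t <= 0]) => //; exact: closed_le.
have {cS} : S (sup S).
  by rewrite {1}(closure_id S).1//; apply: closure_sup => //; exists a.
set c := sup S => -[/= /andP[ac cb] fc0].
(* [c] is the last time in [[a, b]] with [v <= y], so [f] is positive after it. *)
have cmax t : c < t -> t <= b -> 0 < f t.
  move=> ct tb; rewrite ltNge; apply/negP => ft0.
  suff : t <= c by rewrite leNgt ct.
  apply: (ub_le_sup ubS); split => //=.
  by rewrite tb (le_trans ac (ltW ct)).
have {}cb : c < b.
  rewrite lt_neqAle cb andbT; apply/eqP => cb'.
  by move: fc0; rewrite cb' subr_le0 leNgt yvb.
(* A negative [f c] would persist to the right of [c] by continuity, against [cmax]. *)
have fc : f c = 0.
  apply/eqP; rewrite eq_le fc0 leNgt /=; apply/negP => fc1.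
  have : \forall t \near c^'+, f t < 0.
    by apply: (cvgr_lt (f c)) => //; apply: cvg_at_right_filter; exact: cf.
  move=> H; have : \forall t \near c^'+, False.
    near=> t.
    have ft : f t < 0 by near: t; exact: H.
    have ct : c < t by near: t; exact: nbhs_right_gt.
    have tb : t <= b by near: t; exact: nbhs_right_le.
    by have := lt_trans ft (cmax t ct tb); rewrite ltxx.
  by move/filter_not_empty.
have {}ac : a < c.
  rewrite lt_neqAle ac andbT; apply/eqP => ac'.
  by move: fc; rewrite -ac'; apply/eqP; rewrite lt_eqF// subr_lt0.
have vyc : v c = y c by apply/eqP; rewrite -subr_eq0; apply/eqP.
have := dini c; rewrite ac cb => /(_ erefl vyc) dc.
(* A slope strictly between the two derivatives; the Dini derivative may be [-oo], and then
   [dy c - 1] serves. *)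
have [m dm md] : exists2 m, (upper_right_dini v c < m%:E)%E & m < dy c.
  have : (upper_right_dini v c < (dy c)%:E)%E by [].
  case: (upper_right_dini v c) => [r| |] //.
    rewrite lte_fin => rd; exists ((r + dy c) / 2); rewrite ?lte_fin ?midf_lt//.
  by exists (dy c - 1); rewrite ?ltNyr// ltrBlDr ltrDl.
have H1 := upper_right_dini_lt dm.
have H2 := is_derive_right_gt (dery c) md.
(* Just after [c], [v] gains less than [m * t] and [y] gains more, so [f (c + t) < 0], against
   [cmax]. *)
suff : \forall t \near (0:R)^'+, False by move/filter_not_empty.
near=> t.
have t0 : 0 < t by near: t; exact: nbhs_right_gt.
have tb : t <= b - c by near: t; apply: nbhs_right_le; rewrite subr_gt0.
have ft : 0 < f (c + t) by apply: cmax; rewrite ?ltrDl// -lerBrDl.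
have h1 : v (c + t) - v c < m * t by near: t; exact: H1.
have h2 : m * t < y (c + t) - y c by near: t; exact: H2.
by move: ft h1 h2; rewrite /f vyc; lra.
Unshelve. all: by end_near. Qed.

(** Only positive increments count in [0^'+]. This lets a function continuous only on the half-line
    be replaced by its even extension. *)
Lemma upper_right_dini_eq_right v1 v2 (t : R) :
  (forall s, t <= s -> v1 s = v2 s) ->
  (upper_right_dini v1 t <= upper_right_dini v2 t)%E.
Proof.
move=> v12; apply: le_ereal_inf_tmp => _ [A A0 <-].
apply: ereal_inf_le.
exists (ereal_sup [set ((v1 (t + tau) - v1 t) / tau)%:E |
  tau in A `&` [set tau : R | 0 < tau]]).
  exists (A `&` [set tau : R | 0 < tau]) => //.
  by apply: filterI => //; exact: nbhs_right_gt.
apply: le_ereal_sup => _ [tau [Atau tau0] <-]; exists tau => //.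
by rewrite !v12// lerDl ltW.
Qed.

(* [v] is compared with [(v 0 + d (1 + t)) exp (- lambda t)], a strict
   supersolution for every [d > 0]. *)
Lemma dini_exponential_decay v (lambda T : R) : 0 <= T -> continuous v ->
  (forall t, 0 < t < T -> (upper_right_dini v t <= (- lambda * v t)%:E)%E) ->
  v T <= v 0 * expR (- lambda * T).
Proof.
move=> T0 cv dini; apply/ler_addgt0Pr => e e0.
have eT : 0 < (1 + T) * expR (- lambda * T).
  by rewrite mulr_gt0 ?expR_gt0// ltr_wpDr.
(* Chosen so that the perturbation [d (1 + T) exp (- lambda T)] at time [T] is exactly the slack
   [e]. *)
pose d := e / ((1 + T) * expR (- lambda * T)).
have d0 : 0 < d by rewrite divr_gt0.
pose p t : R := v 0 + d * (1 + t).
pose y t : R := p t * expR (- lambda * t).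
(* The positive excess over [- lambda * y t] makes the slope inequality strict wherever
   [v t = y t]. *)
pose dy t : R := - lambda * y t + d * expR (- lambda * t).
have dery (t : R) : is_derive t 1 y (dy t).
  rewrite (_ : y =
    (cst (v 0) + d \*: (cst 1 + id)) * (expR \o (- lambda \*: id)))//.
  apply: is_derive_eq.
  by rewrite /= /GRing.scale/= -[X in X * _ + _]/(p t) /dy /y; ring.
have -> : v 0 * expR (- lambda * T) + e = y T.
  rewrite /y /p mulrDl; congr (_ + _).
  by rewrite -mulrA divfK// gt_eqF.
apply: (dini_comparison T0 cv dery).
  by rewrite /y /p mulr0 expR0 mulr1 addr0 mulr1 ltrDl.
move=> t tT vyt; apply: le_lt_trans (dini t tT) _.
by rewrite lte_fin /dy vyt ltrDl mulr_gt0 ?expR_gt0.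
Qed.

End dini.

(** * Closure properties and inverses of comparison functions *)

Section comparison_functions_theory.
Context {R : realType}.
Implicit Types f g h : R -> R.

(* Even extension turns continuity on the half-line into continuity on R. *)
Lemma within_Rge0_continuousP {S : topologicalType} (f : R -> S) :
  {within Rge0, continuous f} <-> continuous (fun s : R => f `|s|).
Proof.
split=> [/subspace_continuousP cf s W|cf].
  move=> /(cf `|s| (normr_ge0 s)) fW.
  have nc : continuous (fun r : R => `|r|) by exact: norm_continuous.
  have fnear : \forall r \near s, Rge0 `|r| -> W (f `|r|) by exact: nc fW.
  suff : \forall r \near s, W (f `|r|) by [].
  by apply: filterS fnear => r; apply; exact: normr_ge0.
apply: (@subspace_eq_continuous _ _ _ (fun s : R => f `|s|)).
  by move=> s; rewrite inE => s0; rewrite ger0_norm.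
exact: continuous_subspaceT.
Qed.

Lemma classK_le g (r s : R) : classK g -> 0 <= r -> r <= s -> g r <= g s.
Proof.
move=> [_ _ gi _] r0; rewrite le_eqVlt => /predU1P[->//|rs].
by apply/ltW/gi.
Qed.

Lemma classK_gt0 g (s : R) : classK g -> 0 < s -> 0 < g s.
Proof. by move=> [_ _ gi gz] s0; rewrite -[ltLHS]gz; exact: gi. Qed.

Lemma classK_comp g f : classK g -> classK f -> classK (fun s => g (f s)).
Proof.
move=> [/within_Rge0_continuousP cg g0 gi gz].
move=> [/within_Rge0_continuousP cf f0 fi fz]; split.
- apply/within_Rge0_continuousP => s.
  rewrite (_ : (fun s => _) = (fun s : R => g `|s|) \o (fun s : R => f `|s|)).
    by apply: continuous_comp; [exact: cf|exact: cg].
  by apply/funext => r /=; rewrite (ger0_norm (f0 _ _))// normr_ge0.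
- by move=> s s0; by apply/g0/f0.
- by move=> r s r0 rs; apply: gi; [exact: f0|exact: fi].
- by rewrite fz.
Qed.

Lemma classK_scale (a : R) g : 0 < a -> classK g -> classK (fun s => a * g s).
Proof.
move=> a0 [/within_Rge0_continuousP cg g0 gi gz]; split.
- apply/within_Rge0_continuousP => s.
  by apply: cvgM; [exact: cvg_cst|exact: cg].
- by move=> s s0; rewrite mulr_ge0 ?(ltW a0) ?g0.
- by move=> r s r0 rs; rewrite ltr_pM2l//; exact: gi.
- by rewrite gz mulr0.
Qed.

Lemma classK_id : classK (@id R).
Proof. by split => //; apply: continuous_subspaceT => s; exact: cvg_id. Qed.

Lemma classK_add f g : classK f -> classK g -> classK (fun s => f s + g s).
Proof.
move=> [/within_Rge0_continuousP cf f0 fi fz].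
move=> [/within_Rge0_continuousP cg g0 gi gz]; split.
- apply/within_Rge0_continuousP => s.
  by apply: cvgD; [exact: cf|exact: cg].
- by move=> s s0; rewrite addr_ge0 ?f0 ?g0.
- by move=> r s r0 rs; rewrite ltrD ?fi ?gi.
- by rewrite fz gz addr0.
Qed.

Lemma classKinfty_surj g : classKinfty g ->
  forall y, 0 <= y -> exists2 s, 0 <= s & g s = y.
Proof.
move=> [[cg g0 gi gz] ginf] y y0.
have [M [M0 yM]] : exists M, 0 <= M /\ y <= g M.
  have yg : \forall s \near +oo, y <= g s by exact: cvgry_ge.
  have : \forall s \near +oo, 0 <= s /\ y <= g s.
    by apply: filterI => //; exact: nbhs_pinfty_ge.
  exact: filter_ex.
have [||s] := @IVT _ g 0 M y M0.
- apply: continuous_subspaceW cg => s /=; rewrite in_itv/= => /andP[s0 _].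
  exact: s0.
- by rewrite gz ge_min y0 le_max yM orbT.
by rewrite in_itv/= => /andP[s0 _] gs; exists s.
Qed.

(** Preimages are picked by choice. Monotonicity of [g] then converts bounds on [h y] into bounds on
    [y], and these equivalences give the monotonicity and the continuity of [h]. *)
Lemma classKinfty_inverse g : classKinfty g ->
  exists h, [/\ classK h, (forall s, 0 <= s -> h (g s) = s) &
                (forall y, 0 <= y -> g (h y) = y)].
Proof.
move=> ginf; have [gK _] := ginf; have [_ g0 gi gz] := gK.
have /choice[h hP] : forall y, exists s, 0 <= y -> 0 <= s /\ g s = y.
  move=> y; have [y0|y0] := leP 0 y; last by exists 0.
  by have [s s0 gs] := classKinfty_surj ginf y0; exists s.
have h0 y : 0 <= y -> 0 <= h y by move=> /hP[].
have gh y : 0 <= y -> g (h y) = y by move=> /hP[].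
have lt_h y s : 0 <= y -> 0 <= s -> (h y < s) = (y < g s).
  move=> y0 s0; apply/idP/idP => [hs|]; first by rewrite -(gh y)// gi// h0.
  apply: contraTT; rewrite -!leNgt => sh; rewrite -(gh y)//.
  exact: classK_le.
have gt_h y s : 0 <= y -> 0 <= s -> (s < h y) = (g s < y).
  move=> y0 s0; apply/idP/idP => [hs|]; first by rewrite -(gh y)// gi.
  apply: contraTT; rewrite -!leNgt => sh; rewrite -(gh y)//.
  by apply: classK_le => //; exact: h0.
have hg s : 0 <= s -> h (g s) = s.
  by move=> s0; apply/eqP; rewrite eq_le !leNgt lt_h ?gt_h ?ltxx// g0.
exists h; split => //; split => //.
- apply/subspace_continuousP => y; rewrite /Rge0 /= => y0.
  apply/cvgrPdist_lt => e e0 /=.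
  have hye : y < g (h y + e).
    by rewrite -lt_h ?ltrDl// addr_ge0 ?h0// ltW.
  have hle : \forall r \near y, 0 <= r -> h y - e < h r.
    (* The equivalences hold for nonnegative arguments only; when [h y - e] is negative, [0 <= h r]
       suffices. *)
    have [ehy|ehy] := leP 0 (h y - e); last first.
      by near=> r => r0; exact: lt_le_trans ehy (h0 _ r0).
    have ghy : g (h y - e) < y by rewrite -gt_h// gtrBl.
    by near=> r => r0; rewrite gt_h//; near: r; exact: lt_nbhsr.
  have hre : \forall r \near y, 0 <= r -> h r < h y + e.
    near=> r => r0; rewrite lt_h ?addr_ge0 ?h0 ?(ltW e0)//; near: r.
    exact: lt_nbhsl.
  rewrite near_withinE; near=> r => r0 /=; rewrite ltr_distlC.
  by apply/andP; split; move: r0; near: r.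
- by move=> r s r0 rs; rewrite lt_h ?gh// ?h0// (le_trans r0 (ltW rs)).
- by rewrite -[in LHS]gz hg.
Unshelve. all: by end_near. Qed.

(** This is the shape of the ISS bound [beta]. For [s > 0] the argument of [h] decreases strictly to
    [0], where [h] is continuous and vanishes. *)
Lemma classKL_exp_decay h g (lambda : R) : 0 < lambda ->
  classK h -> classK g -> classKL (fun s t => h (expR (- lambda * t) * g s)).
Proof.
move=> l0 hK gK.
have [/within_Rge0_continuousP ch h0 hi hz] := hK.
have [/within_Rge0_continuousP cg g0 gi gz] := gK.
have cE : continuous (fun t : R => expR (- lambda * t)).
  move=> t; apply: (@continuous_comp _ _ _ ( *%R (- lambda)) expR).
    exact: mulrl_continuous.
  exact: continuous_expR.
split.
(* The absolute values change nothing on the quadrant and make the function continuous on the whole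
   plane. *)
- apply: (@subspace_eq_continuous _ _ _
    (fun p : R * R => h `|expR (- lambda * p.2) * g `|p.1| |)).
    move=> p; rewrite inE => -[/= p1 p2].
    by rewrite (ger0_norm p1) ger0_norm// mulr_ge0 ?expR_ge0 ?g0.
  apply: continuous_subspaceT => p.
  apply: (@continuous_comp _ _ _
    (fun p : R * R => expR (- lambda * p.2) * g `|p.1|) (fun s : R => h `|s|));
    last exact: ch.
  apply: cvgM.
    apply: (@continuous_comp _ _ _ snd (fun t : R => expR (- lambda * t))).
      exact: cvg_snd.
    exact: cE.
  apply: (@continuous_comp _ _ _ fst (fun t : R => g `|t|)).
    exact: cvg_fst.
  exact: cg.
- move=> t _; apply: classK_comp => //.
  by apply: classK_scale => //; exact: expR_gt0.
move=> s s0; have gs0 : 0 < g s by exact: classK_gt0.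
have E0 t : 0 <= expR (- lambda * t) * g s by rewrite mulr_ge0 ?expR_ge0 ?ltW.
have hE : (fun t => h (expR (- lambda * t) * g s)) =
    (fun t : R => h `|t|) \o (fun t => expR (- lambda * t) * g s).
  by apply/funext => t /=; rewrite ger0_norm.
split.
- rewrite hE; apply: continuous_subspaceT => t; apply: continuous_comp.
    by apply: cvgM; [exact: cE|exact: cvg_cst].
  exact: ch.
- by move=> t _; exact: h0.
- move=> r t r0 rt; apply: hi => //.
  by rewrite ltr_pM2r// ltr_expR ltr_nM2l// oppr_lt0.
have E_cvg0 : expR (- lambda * t) * g s @[t --> +oo] --> (0 : R).
  have lt_y : lambda * t @[t --> +oo] --> +oo by exact: gt0_cvgMry.
  have E_0 : expR (- (lambda * t)) @[t --> +oo] --> (0 : R).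
    exact: (cvg_comp (fun t => lambda * t) (fun t => expR (- t)) lt_y
      (@cvgr_expR R)).
  under eq_fun do rewrite mulNr.
  have := cvgM E_0 (cvg_cst (g s)).
  by rewrite mul0r; apply.
have := cvg_comp (fun t => expR (- lambda * t) * g s) (fun t => h `|t|)
  E_cvg0 (ch 0).
by rewrite normr0 hz hE.
Qed.

End comparison_functions_theory.

(** Boundedness of [u] and the midpoint [t / 2] make the supremum over []0, t[] a genuine one, so
    that [sup] is monotone here. *)
Lemma sup_norm_on_PC {R : realType} {U : normedModType R} (u : R -> U)
    (t : R) : 0 < t -> PC U u -> 0 <= sup_norm_on `]0, t[ u <= PC_norm u.
Proof.
move=> t0 [_ [M uM]].
have ubM (A : set R) : A `<=` Rge0 -> has_ubound [set `|u s| | s in A].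
  by move=> A0; exists M => _ [s As <-]; apply/uM/A0.
have I0 : `]0, t[ `<=` Rge0.
  by move=> s /=; rewrite in_itv/= => /andP[/ltW].
have It : `]0, t[%classic (t / 2).
  by rewrite /= in_itv/= divr_gt0//= ltr_pdivrMr// ltr_pMr// ltr1n.
apply/andP; split.
  rewrite (le_trans (normr_ge0 (u (t / 2))))//.
  by apply: ub_le_sup; [exact: ubM|exists (t / 2)].
apply: le_sup.
- by move=> _ [s As <-]; exists `|u s|; split => //; exists s => //; exact: I0.
- by exists `|u (t / 2)|, (t / 2).
- split; last exact: ubM.
  by exists `|u 0|, 0 => //; exact: lexx.
Qed.

(** Since [a + b] is at most twice the larger of [a] and [b], one summand on the right suffices and
    the other is nonnegative. *)
Lemma classK_inverse_le_add {R : realType} (g h : R -> R) (a b s : R) :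
  classK h -> (forall r, 0 <= r -> h (g r) = r) ->
  0 <= s -> 0 <= g s -> 0 <= a -> 0 <= b -> g s <= a + b ->
  s <= h (2 * a) + h (2 * b).
Proof.
move=> hK hg s0 gs0 a0 b0 gs; rewrite -[leLHS]hg//.
have [_ h0 _ _] := hK.
have [ab|ba] := leP a b.
  apply: (@le_trans _ _ (h (2 * b))); last by rewrite lerDr h0// mulr_ge0.
  by apply: classK_le => //; lra.
apply: (@le_trans _ _ (h (2 * a))); last by rewrite lerDl h0// mulr_ge0.
by apply: classK_le => //; lra.
Qed.

(** * The decay estimate and input-to-state stability *)

Theorem proposition2p2 (R : realType) (X U : completeNormedModType R)
  (phi : R -> X -> (R -> U) -> X)
  (hphi : forward_complete_control_system (PC U) PC_norm phi)
  (heq : zero_equilibrium phi)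
  (V : X -> R) (psi1 psi2 mu rho : R -> R) (lambda0 : R)
  (hV : continuous V)
  (hpsi1 : classKinfty psi1) (hpsi2 : classKinfty psi2)
  (hmu : classK mu) (hrho : classK rho) (hlambda0 : 0 < lambda0)
  (h_i : forall x : X, 0 <= V x <= psi1 `|x|)
  (h_ii : forall x z : X, psi2 `|x| <= V (x - z) + V (- x - z) + mu `|z|)
  (h_iii : forall (T : R) (u : R -> U), 0 < T -> PC U u ->
     exists z : X, `|z| <= rho (sup_norm_on `]0, T[ u) /\
       forall x : X,
         let v := fun t : R => V (phi t x u - z) + V (- phi t x u - z) in
         forall t : R, 0 < t < T ->
           (upper_right_dini v t <= (- lambda0 * v t)%:E)%E) :
  let gamma := fun s : R => 2 * psi1 (2 * rho s) + mu (rho s) in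
  [/\ ISS (PC U) PC_norm phi,
      classK gamma,
      (classKinfty rho -> classKinfty gamma) &
      forall (t : R) (x : X) (u : R -> U), 0 < t -> PC U u ->
        psi2 `|phi t x u| <=
          2 * expR (- lambda0 * t) * psi1 (2 * `|x|)
          + gamma (sup_norm_on `]0, t[ u)].
Proof.
move=> gamma.
have [psi1K psi1y] := hpsi1; have [psi2K _] := hpsi2.
have [_ psi1_ge0 _ psi1_0] := psi1K; have [_ psi2_ge0 _ _] := psi2K.
have [_ mu_ge0 _ mu_0] := hmu; have [_ rho_ge0 _ _] := hrho.
have two_gt0 : 0 < 2 :> R by [].
have gammaK : classK gamma.
  apply: classK_add; last exact: classK_comp.
  apply: classK_scale => //; apply: classK_comp => //.
  exact: classK_scale.
have [_ gamma_ge0 _ _] := gammaK.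
have Vsum (x z : X) :
    V (x - z) + V (- x - z) <= 2 * psi1 (2 * `|x|) + 2 * psi1 (2 * `|z|).
  (* Stated for any [y] of the norm of [x], so that it serves both [x] and [- x]. *)
  have norm_le (y : X) : `|y| = `|x| ->
      psi1 `|y - z| <= psi1 (2 * `|x|) + psi1 (2 * `|z|).
    move=> yx; have := ler_normB y z; rewrite yx => yz.
    have x0 := normr_ge0 x; have z0 := normr_ge0 z.
    have [xz|zx] := leP `|x| `|z|.
      rewrite (@le_trans _ _ (psi1 (2 * `|z|)))//; last first.
        by rewrite lerDr psi1_ge0// mulr_ge0.
      by apply: classK_le => //; lra.
    rewrite (@le_trans _ _ (psi1 (2 * `|x|)))//; last first.
      by rewrite lerDl psi1_ge0// mulr_ge0.
    by apply: classK_le => //; lra.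
  have /andP[_ V1] := h_i (x - z); have /andP[_ V2] := h_i (- x - z).
  have := norm_le x erefl; have := norm_le (- x) (normrN x); lra.
have estimate (t : R) (x : X) (u : R -> U) : 0 < t -> PC U u ->
    psi2 `|phi t x u| <= 2 * expR (- lambda0 * t) * psi1 (2 * `|x|)
      + gamma (sup_norm_on `]0, t[ u).
  (* The horizon in (iii') is [t] itself, so the bound on [z] involves [u] on []0, t[] only. *)
  move=> t0 uPC; have [z [zrho dini]] := h_iii t u t0 uPC.
  have /andP[s0 _] := sup_norm_on_PC t0 uPC.
  pose v s := V (phi s x u - z) + V (- phi s x u - z).
  have cphi : continuous (fun s : R => phi `|s| x u).
    apply/(within_Rge0_continuousP (fun s => phi s x u)).
    exact: (flow_continuity hphi).
  have cv : continuous (fun s : R => v `|s|).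
    move=> s; apply: cvgD.
      apply: (@continuous_comp _ _ _ (fun s : R => phi `|s| x u - z) V);
        last exact: hV.
      by apply: cvgB; [exact: cphi|exact: cvg_cst].
    apply: (@continuous_comp _ _ _ (fun s : R => - phi `|s| x u - z) V);
      last exact: hV.
    by apply: cvgB; [apply: cvgN; exact: cphi|exact: cvg_cst].
  have vt : v t <= v 0 * expR (- lambda0 * t).
    have := @dini_exponential_decay _ (fun s => v `|s|) lambda0 t (ltW t0) cv.
    rewrite normr0 (gtr0_norm t0); apply => s /andP[s_gt0 st].
    rewrite (gtr0_norm s_gt0).
    apply: le_trans (dini x s _); last by rewrite s_gt0.
    apply: upper_right_dini_eq_right => r sr.
    by rewrite ger0_norm// (le_trans (ltW s_gt0) sr).
  have v0 : v 0 <= 2 * psi1 (2 * `|x|) + 2 * psi1 (2 * `|z|).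
    by rewrite /v (flow_identity hphi)//; exact: Vsum.
  have muz : mu `|z| <= mu (rho (sup_norm_on `]0, t[ u)) by exact: classK_le.
  have psi1z : psi1 (2 * `|z|) <= psi1 (2 * rho (sup_norm_on `]0, t[ u)).
    by apply: classK_le; rewrite ?mulr_ge0// ler_pM2l.
  (* The exponential is kept on the term in [x] and bounded by [1] on the term in [z], which is
     absorbed into [gamma]. *)
  have E0 := expR_ge0 (- lambda0 * t).
  have E1 : expR (- lambda0 * t) <= 1.
    by rewrite -expR0 ler_expR mulNr oppr_le0 mulr_ge0// ltW.
  have P0 : 0 <= psi1 (2 * `|z|) by rewrite psi1_ge0// mulr_ge0.
  have := h_ii (phi t x u) z; rewrite -/(v t) /gamma => hphit.
  have := ler_wpM2r E0 v0; have := ler_wpM2r P0 E1.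
  lra.
split => //; last first.
  (* [gamma] dominates [psi1 (rho s)], which diverges with [rho]. A bounded [rho] would make [gamma]
     bounded, hence the conditional form. *)
  move=> [_ rhoy]; split => //.
  apply: (@ger_cvgy _ _ _ _ (fun s => psi1 (rho s))); last first.
    exact: cvg_comp rhoy psi1y.
  near=> s.
  have s0 : 0 <= s by near: s; exact: nbhs_pinfty_ge.
  have r0 := rho_ge0 _ s0.
  have : psi1 (rho s) <= psi1 (2 * rho s) by apply: classK_le => //; lra.
  have := psi1_ge0 _ r0; have := mu_ge0 _ r0; rewrite /gamma; lra.
have [h [hK hg gh]] := classKinfty_inverse hpsi2.
(* The factor [4] is the [2] of the decay estimate times the [2] from splitting the inverse of
   [psi2] over a sum. *)
pose g s := 4 * psi1 (2 * s).
have gK : classK g.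
  apply: classK_scale => //; apply: classK_comp => //.
  by apply: classK_scale => //; exact: classK_id.
exists (fun s t => h (expR (- lambda0 * t) * g s)), (fun s => h (2 * gamma s)).
split.
- exact: classKL_exp_decay.
- by apply: classK_comp => //; exact: classK_scale.
move=> t x u t0 uPC.
have [N0 NN] : 0 <= PC_norm u /\ 0 <= gamma (PC_norm u).
  have /andP[a b] := sup_norm_on_PC ltr01 uPC.
  by have := le_trans a b; split => //; exact: gamma_ge0.
have -> : expR (- lambda0 * t) * g `|x| =
    2 * (2 * expR (- lambda0 * t) * psi1 (2 * `|x|)).
  by rewrite /g; ring.
apply: (classK_inverse_le_add hK hg) => //; first exact: psi2_ge0.
  by rewrite !mulr_ge0 ?expR_ge0 ?psi1_ge0// mulr_ge0.
move: t0; rewrite le_eqVlt => /predU1P[<-|t0].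
  (* the decay estimate needs 0 < t; at t = 0 use (ii) with z = 0 *)
  rewrite (flow_identity hphi)// mulr0 expR0 mulr1.
  have := h_ii x 0; have := Vsum x 0.
  rewrite normr0 mulr0 psi1_0 mu_0; lra.
(* It remains to enlarge the supremum over []0, t[] to [PC_norm u] inside [gamma]. *)
apply: le_trans (estimate t x u t0 uPC) _; rewrite lerD2l.
have /andP[a b] := sup_norm_on_PC t0 uPC.
exact: classK_le.
Unshelve. all: by end_near. Qed.
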